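(* Let $A\in\mathbb{C}^{n\times n}$ and let $\lambda$ be an eigenvalue of $A$ of algebraic multiplicity $m$ with nonzero Weyr characteristic $m_1\ge\cdots\ge m_k>0$. Set $\mu_0=0$, $\mu_j=m_1+\cdots+m_j$, and $\Phi_\lambda=\{(i,j): \mu_{l-1}<i\le\mu_l,\ i<j\le\mu_l,\ l=1,\dots,k\}$. Then for almost all vectors $\mathbf{b}_1,\dots,\mathbf{b}_m,\mathbf{c}_1,\dots,\mathbf{c}_m\in\mathbb{C}^n$ there is a unique pair of matrices $Y=[\mathbf{y}_1,\dots,\mathbf{y}_m]\in\mathbb{C}^{n\times m}$ and $S\in\mathbb{C}^{m\times m}$, with $S$ a staircase nilpotent matrix with respect to $m_1,\dots,m_k$, such that $$\begin{cases}(A-\lambda I)Y=YS,\\ [\mathbf{c}_1,\dots,\mathbf{c}_i]^{\mathsf H}\mathbf{y}_i=(0,\dots,0,1)^{\top}\in\mathbb{C}^i, & 1\le i\le m,\\ \mathbf{b}_j^{\mathsf H}\mathbf{y}_i=0, & (i,j)\in\Phi_\lambda.\end{cases}$$ Moreover, the Jacobian of the map $\mathbf{f}$ defined below is of full column rank at $(\lambda,Y,S)$.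
   Context: The Weyr characteristic of $A$ at $\lambda$ is $m_j=\dim\ker(A-\lambda I)^j-\dim\ker(A-\lambda I)^{j-1}$, $j\ge1$; its nonzero part $m_1\ge\cdots\ge m_k$ sums to $m$. A staircase nilpotent matrix with respect to $m_1,\dots,m_k$ is an $S\in\mathbb{C}^{m\times m}$ which, partitioned into blocks $S_{ij}\in\mathbb{C}^{m_i\times m_j}$, has $S_{ij}=O$ for $i\ge j$; let $\mathcal{S}$ denote the space of such matrices, whose free entries are those of the blocks $S_{ij}$ with $i<j$ (so $\mathcal S\cong\mathbb{C}^{\sum_{i<j}m_im_j}$). With $\mathbf b_j,\mathbf c_j$ fixed, define $\mathbf{f}:\mathbb{C}\times\mathbb{C}^{n\times m}\times\mathcal S\to\mathbb{C}^{\eta}$, $\eta=nm+\tfrac{m(m+1)}{2}+|\Phi_\lambda|$, by $\mathbf f(\lambda,Y,S)$ = the vector whose components are the entries of the columns $((A-\lambda I)Y-YS)\mathbf e_1,\dots,((A-\lambda I)Y-YS)\mathbf e_m$, followed by the numbers $\mathbf c_j^{\mathsf H}\mathbf y_i-\delta_{ij}$ for $1\le j\le i\le m$, followed by the numbers $\mathbf b_j^{\mathsf H}\mathbf y_i$ for $(i,j)\in\Phi_\lambda$ ($\delta_{ij}$ the Kronecker delta). The Jacobian is the complex $\eta\times\zeta$ matrix of partial derivatives of $\mathbf f$ with respect to the $\zeta=1+nm+\sum_{i<j}m_im_j$ variables $\lambda$, the entries of $Y$, and the free entries of $S$ ($\mathbf f$ is holomorphic in these variables). ''For almost all'' means outside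 a set of Lebesgue measure zero. *)

(* Defs.v *)
From HB Require Import structures.
From mathcomp Require Import all_boot all_order all_algebra.
From mathcomp Require Import all_classical all_reals all_analysis.
From mathcomp Require Import complex.
Set Implicit Arguments.
Unset Strict Implicit.
Unset Printing Implicit Defensive.
Import Order.TTheory GRing.Theory Num.Theory.
Import numFieldNormedType.Exports.
Local Open Scope ring_scope.

Section Defs.
Variable R : realType.
Local Notation C := (R[i]).

Definition hdot (p : nat) (u v : 'cV[C]_p) : C :=
  \sum_(r < p) conjc (u r 0) * v r 0.

(* dim ker M  (column kernel: the x with M x = 0, i.e. x^T M^T = 0). *)
Definition dimker (p : nat) (M : 'M[C]_p) : nat := \rank (kermx M^T).

(* Weyr characteristic m_j = dim ker (A - lam I)^j - dim ker (A - lam I)^(j-1),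
   meaningful for j >= 1. *)
Definition weyr (n : nat) (A : 'M[C]_n) (lam : C) (j : nat) : nat :=
  (dimker ((A - lam%:M) ^+ j) - dimker ((A - lam%:M) ^+ j.-1))%N.

Definition mu (w : nat -> nat) (l : nat) : nat := (\sum_(1 <= j < l.+1) w j)%N.

(* 0-based block index of the 0-based position i: the number of l in 1..k with
   mu_l <= i.  Position i (0-based) lies in block blk i (0-based), i.e.
   mu_(blk i) <= i < mu_(blk i + 1). *)
Definition blk (w : nat -> nat) (k : nat) (i : nat) : nat :=
  (\sum_(1 <= l < k.+1) (mu w l <= i))%N.

Definition staircase (w : nat -> nat) (k m : nat) (S : 'M[C]_m) : Prop :=
  forall i j : 'I_m, (blk w k j <= blk w k i)%N -> S i j = 0.

Definition Phi (w : nat -> nat) (k : nat) (i j : nat) : bool :=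
  (blk w k i == blk w k j) && (i < j)%N.

Definition wsystem (n m k : nat) (A : 'M[C]_n) (lam : C) (B Cm Y : 'M[C]_(n, m))
    (S : 'M[C]_m) : Prop :=
  [/\ (A - lam%:M) *m Y = Y *m S,
      (forall i j : 'I_m, (j <= i)%N ->
         hdot (col j Cm) (col i Y) = (i == j)%:R)
    & (forall i j : 'I_m, Phi (weyr A lam) k i j -> hdot (col j B) (col i Y) = 0)].

(* Variables of f: lambda, the entries of Y, the free entries of S. *)
Definition Svar (w : nat -> nat) (k m : nat) :=
  {p : 'I_m * 'I_m | (blk w k p.1 < blk w k p.2)%N}.
Definition Var (w : nat -> nat) (k n m : nat) :=
  ((unit + ('I_n * 'I_m)) + Svar w k m)%type.
(* Components of f: residual entries, c-conditions (j <= i), b-conditions. *)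
Definition Cidx (m : nat) := {p : 'I_m * 'I_m | (p.2 <= p.1)%N}.
Definition Bidx (w : nat -> nat) (k m : nat) := {p : 'I_m * 'I_m | Phi w k p.1 p.2}.
Definition Out (w : nat -> nat) (k n m : nat) :=
  ((('I_n * 'I_m) + Cidx m) + Bidx w k m)%type.

Section F.
Variables (n m k : nat) (A : 'M[C]_n) (lam0 : C) (B Cm : 'M[C]_(n, m)).
Local Notation w := (weyr A lam0).
Local Notation V := (Var w k n m).
Local Notation O := (Out w k n m).

Definition lam_of (x : V -> C) : C := x (inl (inl tt)).
Definition Y_of (x : V -> C) : 'M[C]_(n, m) := \matrix_(r, i) x (inl (inr (r, i))).
Definition S_of (x : V -> C) : 'M[C]_m :=
  \matrix_(i, j) odflt 0 (omap (fun q => x (inr q)) (insub (i, j) : option (Svar w k m))).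

Definition fmap (x : V -> C) (o : O) : C :=
  let Y := Y_of x in
  match o with
  | inl (inl (r, i)) => ((A - (lam_of x)%:M) *m Y - Y *m S_of x) r i
  | inl (inr q) => hdot (col (val q).2 Cm) (col (val q).1 Y) - ((val q).1 == (val q).2)%:R
  | inr q => hdot (col (val q).2 B) (col (val q).1 Y)
  end.

Definition point (lam : C) (Y : 'M[C]_(n, m)) (S : 'M[C]_m) (v : V) : C :=
  match v with
  | inl (inl _) => lam
  | inl (inr (r, i)) => Y r i
  | inr q => S (val q).1 (val q).2
  end.

Definition jac (x0 : V -> C) (o : O) (v : V) : C :=
  derive1 (fun t : C^o => (fmap (fun u => x0 u + (if u == v then t else 0)) o : C^o)) 0.

Definition jac_mx (x0 : V -> C) : 'M[C]_(#|{: O}|, #|{: V}|) :=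
  \matrix_(p, q) jac x0 (enum_val p) (enum_val q).

Definition jac_full_col_rank (lam : C) (Y : 'M[C]_(n, m)) (S : 'M[C]_m) : Prop :=
  \rank (jac_mx (point lam Y S)) = #|{: V}|.
End F.

(* Lebesgue-null subsets of C^I (identified with R^(2|I|)): for every eps > 0
   the set is covered by countably many (nondegenerate-oriented) boxes of
   total volume <= eps. *)
Definition cnull (I : finType) (E : (I -> C) -> Prop) : Prop :=
  forall eps : R, 0 < eps ->
  exists lo hi : nat -> I -> C,
    [/\ (forall p i, complex.Re (lo p i) <= complex.Re (hi p i) /\
                     complex.Im (lo p i) <= complex.Im (hi p i)),
        (forall x, E x -> exists p : nat, forall i,
            (complex.Re (lo p i) <= complex.Re (x i) <= complex.Re (hi p i)) /\
            (complex.Im (lo p i) <= complex.Im (x i) <= complex.Im (hi p i)))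
      & (forall N : nat, \sum_(p < N) \prod_(i : I)
            ((complex.Re (hi p i) - complex.Re (lo p i)) *
             (complex.Im (hi p i) - complex.Im (lo p i))) <= eps)].

Definition ae_pair (n m : nat) (P : 'M[C]_(n, m) -> 'M[C]_(n, m) -> Prop) : Prop :=
  exists E : ((('I_n * 'I_m) + ('I_n * 'I_m))%type -> C) -> Prop,
    cnull E /\
    forall x, ~ E x ->
      P (\matrix_(r, j) x (inl (r, j))) (\matrix_(r, j) x (inr (r, j))).
End Defs.

(* Main.v *)
Require Import Defs.
From HB Require Import structures.
From mathcomp Require Import all_boot all_order all_algebra.
From mathcomp Require Import all_classical all_reals all_analysis.
From mathcomp Require Import complex ring lra.
Import Order.TTheory GRing.Theory Num.Theory.
Import numFieldNormedType.Exports.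
Set Implicit Arguments.
Unset Strict Implicit.
Unset Printing Implicit Defensive.
Local Open Scope ring_scope.

(* With N = A - lam I, a solution column y_i in block l lies in ker N^l, a space of dimension
   mu_l, and is subject to exactly mu_l affine conditions: i of them involving c_1, ..., c_i and
   mu_l - i involving b_(i+1), ..., b_(mu_l).  For almost all b, c the determinants of these m
   square systems do not vanish, which gives existence and uniqueness of Y.  The c-conditions
   make C^H Y unit lower triangular, so Y has a left inverse X, the columns of Y in the first l
   blocks form a basis of ker N^l, and S = X N Y is forced.

   A kernel vector (s, Z, T) of the Jacobian satisfies N Z - s Y - Z S - Y T = 0 and the
   homogeneous conditions.  Its columns lie in ker N^k, so Z = Y W and S W - W S = s I + T; the
   trace gives s = 0, and then each column of Z solves the homogeneous square system above.

   The determinants are affine in each real coordinate of (b, c).  The zero set of a nonzero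
   multi-affine function a + b x_v is, by induction on the number of variables, null where b = 0,
   and a countable union of Lipschitz graphs x_v = - a / b elsewhere. *)

(** * Null sets *)

Section NullSets.
Variable R : realType.

(** * Covers by boxes: countable unions and Lipschitz graphs *)

Section Covers.
Variable J : finType.
Implicit Types (E : (J -> R) -> Prop) (lo hi : J -> R).

Definition boxvol lo hi : R := \prod_(u : J) (hi u - lo u).

Definition rnull E : Prop :=
  forall eps : R, 0 < eps ->
  exists lo hi : nat -> J -> R,
    [/\ forall p u, lo p u <= hi p u,
        forall x, E x -> exists p, forall u, lo p u <= x u <= hi p u
      & forall N, \sum_(p < N) boxvol (lo p) (hi p) <= eps].

Lemma boxvol_ge0 lo hi : (forall u, lo u <= hi u) -> 0 <= boxvol lo hi.
Proof. by move=> h; apply: prodr_ge0 => u _; rewrite subr_ge0. Qed.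

Lemma boxvol_cst (v : J) (c : R) : boxvol (fun=> c) (fun=> c) = 0.
Proof. by rewrite /boxvol (bigD1 v) //= subrr mul0r. Qed.

Lemma rnull_sub E E' : (forall x, E x -> E' x) -> rnull E' -> rnull E.
Proof.
move=> sub nE' eps /nE'[lo [hi [h1 h2 h3]]].
by exists lo, hi; split=> // x /sub /h2.
Qed.

Lemma ler_sum_uniq (K : eqType) (s t : seq K) (F : K -> R) :
  uniq s -> uniq t -> {subset s <= t} -> (forall k, 0 <= F k) ->
  \sum_(k <- s) F k <= \sum_(k <- t) F k.
Proof.
move=> us ut st F0; rewrite [leRHS](bigID (mem s)) /=.
have -> : \sum_(k <- s) F k = \sum_(k <- t | k \in s) F k.
  rewrite -[RHS]big_filter; apply: perm_big; apply: uniq_perm => //.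
    by rewrite filter_uniq.
  move=> k; rewrite mem_filter.
  by case: (boolP (k \in s)) => //= /st ->.
by rewrite lerDl sumr_ge0.
Qed.

(** Covers may be indexed by any countable type, with partial sums over duplicate-free lists. The
    coordinate [v] makes [J] inhabited: an empty product would give padding boxes volume 1 instead
    of 0. *)
Lemma rnull_cover (v : J) E :
  (forall eps : R, 0 < eps -> exists (K : countType) (lo hi : K -> J -> R),
    [/\ forall p u, lo p u <= hi p u,
        forall x, E x -> exists p, forall u, lo p u <= x u <= hi p u
      & forall s : seq K, uniq s ->
          \sum_(p <- s) boxvol (lo p) (hi p) <= eps]) ->
  rnull E.
Proof.
move=> H eps /H[K [lo [hi [h1 h2 h3]]]].
pose ext (f : K -> J -> R) p := if @pickle_inv K p is Some c then f c else fun=> 0.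
exists (ext lo), (ext hi); split.
- by move=> p u; rewrite /ext; case: pickle_inv.
- move=> x /h2[c hc]; exists (pickle c) => u.
  by rewrite /ext pickleK_inv.
- move=> N.
  have -> : \sum_(p < N) boxvol (ext lo p) (ext hi p) =
      \sum_(c <- pmap (@pickle_inv K) (iota 0 N)) boxvol (lo c) (hi c).
    rewrite -(big_mkord xpredT (fun p => boxvol (ext lo p) (ext hi p))).
    rewrite /index_iota subn0.
    elim: (iota 0 N) => [|p s IH]; first by rewrite !big_nil.
    rewrite big_cons IH /ext /=; case: (pickle_inv p) => [c|] /=.
      by rewrite big_cons.
    by rewrite (boxvol_cst v) add0r.
  by apply: h3; apply: pmap_uniq (iota_uniq _ _); exact: pickle_invK.
Qed.

Lemma sum_half_pow (s : seq nat) : uniq s -> \sum_(q <- s) (2^-1 : R) ^+ q.+1 <= 1.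
Proof.
move=> us; pose Q := (\max_(q <- s) q).+1.
apply: (@le_trans _ _ (\sum_(q <- iota 0 Q) (2^-1 : R) ^+ q.+1)).
  apply: ler_sum_uniq => //; first exact: iota_uniq.
    by move=> q qs; rewrite mem_iota /= add0n ltnS (leq_bigmax_seq q qs).
suff -> : \sum_(q <- iota 0 Q) (2^-1 : R) ^+ q.+1 = 1 - (2^-1) ^+ Q.
  by rewrite gerBl exprn_ge0 // invr_ge0.
elim: Q => [|Q IH]; first by rewrite big_nil expr0 subrr.
by rewrite -addn1 iotaD big_cat /= big_seq1 IH add0n addn1 exprS; field.
Qed.

(** The set with code $c$ is covered with total volume at most $\varepsilon 2^{-c-1}$. *)
Lemma rnull_bigcup (v : J) (T : countType) (E : T -> (J -> R) -> Prop) :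
  (forall t, rnull (E t)) -> rnull (fun x => exists t, E t x).
Proof.
move=> nE; apply: (rnull_cover v) => eps eps0.
have /choice[lo /choice[hi H]] : forall t : T, exists lo hi : nat -> J -> R,
    [/\ forall p u, lo p u <= hi p u,
        forall x, E t x -> exists p, forall u, lo p u <= x u <= hi p u
      & forall N, \sum_(p < N) boxvol (lo p) (hi p) <= eps * 2^-1 ^+ (pickle t).+1].
  by move=> t; apply: nE; rewrite mulr_gt0 // exprn_gt0 // invr_gt0.
exists (T * nat)%type, (fun c => lo c.1 c.2), (fun c => hi c.1 c.2).
split=> [[t p] u|x [t Ex]|s us]; first by case: (H t).
  by case: (H t) => _ /(_ x Ex)[p hp] _; exists (t, p).
(* A finite set of pairs lies in a rectangle [ts] times $\{0,\dots,Q-1\}$, whose rows are bounded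
   one by one. *)
pose ts := undup (map fst s); pose Q := (\max_(c <- s) c.2).+1.
pose F (c : T * nat) := boxvol (lo c.1 c.2) (hi c.1 c.2).
have F0 c : 0 <= F c by apply: boxvol_ge0; case: (H c.1).
apply: (@le_trans _ _ (\sum_(c <- [seq (t, p) | t <- ts, p <- iota 0 Q]) F c)).
  apply: ler_sum_uniq => //.
    by apply: allpairs_uniq; rewrite ?undup_uniq ?iota_uniq // => -[? ?] [? ?].
  move=> -[t p] cs; apply/allpairsP; exists (t, p); split=> //.
    by rewrite mem_undup; apply/mapP; exists (t, p).
  by rewrite mem_iota /= add0n ltnS (@leq_bigmax_seq _ s xpredT (fun c : T * nat => c.2) _ cs).
rewrite big_allpairs.
apply: (@le_trans _ _ (\sum_(t <- ts) eps * 2^-1 ^+ (pickle t).+1)).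
  apply: ler_sum => t _; case: (H t) => _ _ /(_ Q).
  by rewrite -(big_mkord xpredT (fun p => boxvol (lo t p) (hi t p))) /index_iota subn0.
rewrite -mulr_sumr -[leRHS]mulr1; apply: ler_wpM2l; first exact: ltW.
have := @sum_half_pow (map pickle ts); rewrite big_map; apply.
by rewrite map_inj_uniq ?undup_uniq //; exact: (pcan_inj pickleK).
Qed.

Lemma rnullU (v : J) E E' : rnull E -> rnull E' -> rnull (fun x => E x \/ E' x).
Proof.
move=> nE nE'; apply: (@rnull_sub _ (fun x => exists b : bool, (if b then E else E') x)).
  by move=> x [Ex|Ex]; [exists true|exists false].
by apply: (rnull_bigcup v) => -[].
Qed.

Lemma rnull_pred0 (v : J) E : (forall x, ~ E x) -> rnull E.
Proof.
move=> nE eps eps0; exists (fun _ _ => 0), (fun _ _ => 0).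
split=> [//|x /nE //|N]; rewrite big1 ?ltW // => p _.
by rewrite (boxvol_cst v).
Qed.

Lemma unit_cell (M : nat) (t : R) : 0 <= t <= M.+1%:R ->
  exists c : 'I_M.+1, c%:R <= t <= c%:R + 1.
Proof.
elim: M => [|M IH] /andP[t0 tM]; first by exists ord0; rewrite /= t0 add0r.
have [tM'|Mt] := leP t M.+1%:R.
  have [|c hc] := IH; first by rewrite t0.
  by exists (widen_ord (leqnSn _) c).
by exists ord_max; rewrite /= (ltW Mt) natr1.
Qed.

(** The cube $[-q,q]^D$ in the coordinates other than [v] is cut into $(M+1)^D$ cells of side
    $h=2q/(M+1)$. Over one cell the coordinate [v] stays within $Lh$ of a fixed value, so the total
    volume is $O(1/M)$. *)
Lemma rnull_graph (v : J) E (q L : R) :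
  0 <= L ->
  (forall x, E x -> forall u, `|x u| <= q) ->
  (forall x y d, E x -> E y -> 0 <= d -> (forall u, u != v -> `|x u - y u| <= d) ->
     `|x v - y v| <= L * d) ->
  rnull E.
Proof.
move=> L0 Eb El; have [ex0|nE] := pselect (exists x, E x); last first.
  by apply: (rnull_pred0 v) => x Ex; apply: nE; exists x.
have q0 : 0 <= q by have [x Ex] := ex0; exact: le_trans (normr_ge0 _) (Eb x Ex v).
apply: (rnull_cover v) => eps eps0.
pose D := #|[pred u | u != v]|.
(* [c0] is the total volume of the boxes multiplied by $M+1$. *)
pose c0 := (2 * q) ^+ D * (2 * L * (2 * q)).
have c00 : 0 <= c0 by rewrite /c0 !mulr_ge0 ?exprn_ge0 ?mulr_ge0.
pose M := Num.truncn (c0 / eps).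
have hM : c0 / M.+1%:R <= eps.
  rewrite ler_pdivrMr ?ltr0n // mulrC -ler_pdivrMr //.
  by rewrite ltW // truncnS_gt.
pose h := 2 * q / M.+1%:R.
have h0 : 0 <= h by rewrite /h divr_ge0 ?mulr_ge0.
pose I := {u : J | u != v}.
pose K := {ffun I -> 'I_M.+1}.
pose cell (f : K) x := forall u : I, - q + (f u)%:R * h <= x (val u) <= - q + ((f u)%:R + 1) * h.
(* The centre is a point of [E] over the cell; a cell without such a point takes the default 0, and
   its box has the same volume. *)
pose ctr (f : K) : J -> R := xget (fun=> 0) (fun x => E x /\ cell f x).
pose lo (f : K) u := if insub u is Some u' then - q + (f u')%:R * h else ctr f v - L * h.
pose hi (f : K) u := if insub u is Some u' then - q + ((f u')%:R + 1) * h else ctr f v + L * h.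
have lh : 0 <= L * h by rewrite mulr_ge0.
exists K, lo, hi; split.
- move=> f u; rewrite /lo /hi; case: insubP => [u' _ _|_]; last by lra.
  by rewrite mulrDl mul1r; lra.
- move=> x Ex.
  have /fin_all_exists[f hf] : forall u : I, exists c : 'I_M.+1,
      - q + c%:R * h <= x (val u) <= - q + (c%:R + 1) * h.
    move=> u; have := Eb _ Ex (val u); rewrite ler_norml => /andP[xl xr].
    (* For $q=0$ the side [h] is 0 and cannot be divided by, but then all coordinates vanish. *)
    have [qe|qn] := eqVneq q 0.
      exists ord0; rewrite /h qe mulr0 mul0r !mulr0 oppr0 addr0.
      by move: xl xr; rewrite qe oppr0 => -> ->.
    have h1 : 0 < h by rewrite /h divr_gt0 ?mulr_gt0 // lt_neqAle eq_sym qn.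
    have [|c /andP[c1 c2]] := @unit_cell M ((x (val u) + q) / h).
      rewrite divr_ge0 //=; last by lra.
      rewrite ler_pdivrMr // /h mulrC divfK ?pnatr_eq0 //; lra.
    exists c; move: c1 c2; rewrite ler_pdivlMr // ler_pdivrMr //; lra.
  pose F : K := [ffun u => f u].
  have Fx : cell F x by move=> u; rewrite ffunE.
  have [Ec Fc] : E (ctr F) /\ cell F (ctr F).
    by apply: (@xgetPex _ (fun=> 0) (fun x => E x /\ cell F x)); exists x.
  exists F => w; rewrite /lo /hi; case: insubP => [u' _ <-|]; first exact: Fx.
  rewrite negbK => /eqP ->; rewrite -ler_distl; apply: El => // u uv.
  have := Fx (Sub u uv); have := Fc (Sub u uv); rewrite SubK.
  by rewrite ler_norml !mulrDl !mul1r; lra.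
- move=> s us; apply: le_trans hM.
  apply: (@le_trans _ _ (\sum_(f : K) boxvol (lo f) (hi f))).
    apply: ler_sum_uniq => //; first exact: index_enum_uniq.
      by move=> f _; rewrite mem_index_enum.
    move=> f; apply: boxvol_ge0 => u; rewrite /lo /hi.
    by case: insubP => [u' _ _|_]; rewrite ?mulrDl ?mul1r; lra.
  have vol f : boxvol (lo f) (hi f) = 2 * (L * h) * h ^+ D.
    rewrite /boxvol (bigD1 v) //= {1}/lo {1}/hi insubF ?eqxx //.
    rewrite (eq_bigr (fun=> h)); last first.
      by move=> u uv; rewrite /lo /hi (insubT (fun u => u != v) uv) mulrDl mul1r; lra.
    by rewrite prodr_const -/D; ring.
  rewrite (eq_bigr _ (fun f _ => vol f)) sumr_const card_ffun card_ord.
  rewrite card_sig -/D -[leLHS]mulr_natr natrX.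
  rewrite /c0 /h expr_div_n le_eqVlt; apply/orP; left; apply/eqP.
  field; rewrite nat1r pnatr_eq0 /=.
by rewrite expf_neq0 // pnatr_eq0.
Qed.

End Covers.

(** * Zero sets of multi-affine functions *)

Section MultiAffine.
Variable J : finType.
Implicit Types (p : (J -> R) -> R) (x y : J -> R).

Definition upd x (v : J) (t : R) : J -> R := fun u => if u == v then t else x u.

(** Lipschitz in the sup norm on each cube; [d] is any upper bound of the distance, so that no
    maximum over [J] is formed. *)
Definition loc_lip p : Prop :=
  forall q : R, 0 <= q -> exists2 L : R, 0 <= L &
    forall x y d, (forall u, `|x u| <= q) -> (forall u, `|y u| <= q) -> 0 <= d ->
      (forall u, `|x u - y u| <= d) -> `|p x - p y| <= L * d.

Definition multi_affine p : Prop :=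
  forall x v t, p (upd x v t) = p (upd x v 0) + t * (p (upd x v 1) - p (upd x v 0)).

Lemma upd_id x v : upd x v (x v) = x.
Proof. by apply/funext => u; rewrite /upd; case: eqP => [->|]. Qed.

Lemma upd_upd x v s t : upd (upd x v s) v t = upd x v t.
Proof. by apply/funext => u; rewrite /upd; case: eqP. Qed.

Lemma upd_comm x v w s t : v != w -> upd (upd x v s) w t = upd (upd x w t) v s.
Proof.
move=> vw; apply/funext => u; rewrite /upd.
by case: eqP => // ->; rewrite eq_sym (negPf vw).
Qed.

Lemma loc_lip_cst (c : R) : loc_lip (fun=> c).
Proof. by move=> q q0; exists 0 => // *; rewrite subrr normr0 mul0r. Qed.

Lemma loc_lip_var u : loc_lip (fun x => x u).
Proof. by move=> q q0; exists 1 => // x y d _ _ _ /(_ u); rewrite mul1r. Qed.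

Lemma loc_lipD p1 p2 : loc_lip p1 -> loc_lip p2 -> loc_lip (fun x => p1 x + p2 x).
Proof.
move=> h1 h2 q q0; have [L1 L10 H1] := h1 q q0; have [L2 L20 H2] := h2 q q0.
exists (L1 + L2) => [|x y d xq yq d0 xy]; first by rewrite addr_ge0.
rewrite opprD addrACA mulrDl (le_trans (ler_normD _ _)) // lerD //.
  exact: H1.
exact: H2.
Qed.

Lemma loc_lipN p : loc_lip p -> loc_lip (fun x => - p x).
Proof.
move=> h q q0; have [L L0 H] := h q q0; exists L => // x y d xq yq d0 xy.
by rewrite -opprD normrN; exact: H.
Qed.

Lemma loc_lip_bound p q : loc_lip p -> 0 <= q ->
  exists2 K : R, 0 <= K & forall x, (forall u, `|x u| <= q) -> `|p x| <= K.
Proof.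
move=> h q0; have [L L0 H] := h q q0; exists (`|p (fun=> 0)| + L * q).
  by rewrite addr_ge0 // mulr_ge0.
move=> x xq; rewrite -{1}(subrK (p (fun=> 0)) (p x)) addrC.
rewrite (le_trans (ler_normD _ _)) // lerD2l; apply: H => // u.
  by rewrite normr0.
by rewrite subr0.
Qed.

Lemma loc_lipM p1 p2 : loc_lip p1 -> loc_lip p2 -> loc_lip (fun x => p1 x * p2 x).
Proof.
move=> h1 h2 q q0; have [L1 L10 H1] := h1 q q0; have [L2 L20 H2] := h2 q q0.
have [K1 K10 B1] := loc_lip_bound h1 q0; have [K2 K20 B2] := loc_lip_bound h2 q0.
exists (K1 * L2 + K2 * L1) => [|x y d xq yq d0 xy].
  by rewrite addr_ge0 // mulr_ge0.
have -> : p1 x * p2 x - p1 y * p2 y = p1 x * (p2 x - p2 y) + p2 y * (p1 x - p1 y).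
  by ring.
rewrite mulrDl -!mulrA (le_trans (ler_normD _ _)) // !normrM.
by apply: lerD; apply: ler_pM => //; [exact: B1|exact: H2|exact: B2|exact: H1].
Qed.

Lemma loc_lip_upd p v t : loc_lip p -> loc_lip (fun x => p (upd x v t)).
Proof.
move=> h q q0; have [|L L0 H] := h (q + `|t|); first by rewrite addr_ge0.
have bd x : (forall u, `|x u| <= q) -> forall u, `|upd x v t u| <= q + `|t|.
  move=> xq u; rewrite /upd; case: eqP => _; first by rewrite lerDr.
  by rewrite (le_trans (xq u)) // lerDl.
exists L => // x y d xq yq d0 xy; apply: H => //; try exact: bd.
by move=> u; rewrite /upd; case: eqP; rewrite ?subrr ?normr0.
Qed.

Lemma multi_affine_upd p v t : multi_affine p -> multi_affine (fun x => p (upd x v t)).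
Proof.
move=> h x w s; have [->|wv] := eqVneq w v; first by rewrite !upd_upd subrr mulr0 addr0.
by rewrite !(upd_comm _ _ _ wv) h.
Qed.

Lemma multi_affineB p1 p2 : multi_affine p1 -> multi_affine p2 ->
  multi_affine (fun x => p1 x - p2 x).
Proof. by move=> h1 h2 x v t; rewrite h1 h2; ring. Qed.

(* The part of [{p = 0}] where the slope [b] of [p] in the variable [v] does not vanish is
   a countable union of bounded Lipschitz graphs [x v = - a x / b x]. *)
Lemma rnull_slope p v (a := fun x => p (upd x v 0))
    (b := fun x => p (upd x v 1) - p (upd x v 0)) :
  multi_affine p -> loc_lip p -> rnull (fun x => p x = 0 /\ b x <> 0).
Proof.
move=> ap lp.
have la : loc_lip a by exact: loc_lip_upd.
have lb : loc_lip b by apply: loc_lipD; [|apply: loc_lipN]; exact: loc_lip_upd.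
(* [G N] confines the point to a cube and keeps the slope at least $1/(N+1)$ in modulus; these sets
   exhaust the part in question. *)
pose G (N : nat) x := [/\ p x = 0, forall u, `|x u| <= N%:R & N.+1%:R^-1 <= `|b x|].
apply: (@rnull_sub _ _ (fun x => exists N, G N x)).
  move=> x [px0 /eqP bx0].
  pose N1 := Num.truncn (`|b x|^-1); pose N2 := (\max_u (Num.truncn `|x u|).+1)%N.
  exists (maxn N1 N2); split=> //.
    move=> u; apply: le_trans (ltW (truncnS_gt _)) _; rewrite ler_nat.
    by apply: leq_trans (leq_maxr _ _); exact: (leq_bigmax (F := fun u => (Num.truncn `|x u|).+1)).
  rewrite invf_ple ?posrE ?normr_gt0 ?ltr0n //.
  apply: le_trans (ltW (truncnS_gt _)) _; rewrite ler_nat ltnS; exact: leq_maxl.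
apply: (rnull_bigcup v) => N.
have N0 : 0 <= N%:R :> R by rewrite ler0n.
have [La La0 Ha] := la _ N0; have [Lb Lb0 Hb] := lb _ N0.
have [Ka Ka0 Ba] := loc_lip_bound la N0; have [Kb Kb0 Bb] := loc_lip_bound lb N0.
pose c : R := N.+1%:R.
(* In the difference of the two quotients the numerator is at most $(K_bL_a+K_aL_b)d$, and $c=N+1$
   bounds both factors $1/|b|$. *)
apply: (@rnull_graph _ v _ N%:R ((Kb * La + Ka * Lb) * c ^+ 2)).
- by rewrite mulr_ge0 ?exprn_ge0 ?addr_ge0 ?mulr_ge0 // ler0n.
- by move=> x [].
move=> x y d [px xq bx] [py yq by_] d0 xy.
have c0 : 0 < c by rewrite ltr0n.
have ne z : c^-1 <= `|b z| -> b z != 0.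
  by move=> h; rewrite -normr_gt0; apply: lt_le_trans h; rewrite invr_gt0.
have E z : p z = 0 -> b z != 0 -> z v = - a z / b z.
  move=> pz bz; have := ap z v (z v); rewrite upd_id pz -/(a z) -/(b z) => h.
  have {h} -> : a z = - (z v * b z) by apply/eqP; rewrite -addr_eq0 -h.
  by rewrite opprK mulfK.
(* Neither [a] nor [b] sees the coordinate [v]. Setting it to 0 in both points makes them [d]-close
   in every coordinate, as the Lipschitz bounds require. *)
have upd0 (f : (J -> R) -> R) : (forall z t, f (upd z v t) = f z) ->
    f x - f y = f (upd x v 0) - f (upd y v 0).
  by move=> h; rewrite !h.
have bd z : (forall u, `|z u| <= N%:R) -> forall u, `|upd z v 0 u| <= N%:R.
  by move=> h u; rewrite /upd; case: eqP; rewrite ?normr0.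
have xy0 u : `|upd x v 0 u - upd y v 0 u| <= d.
  by rewrite /upd; case: eqP => [|/eqP /xy //]; rewrite subrr normr0.
have dA : `|a x - a y| <= La * d.
  rewrite (upd0 a); last by move=> z t; rewrite /a upd_upd.
  by apply: Ha => //; exact: bd.
have dB : `|b x - b y| <= Lb * d.
  rewrite (upd0 b); last by move=> z t; rewrite /b !upd_upd.
  by apply: Hb => //; exact: bd.
have nx := ne _ bx; have ny := ne _ by_.
rewrite (E x) // (E y) //.
have -> : - a x / b x - - a y / b y =
    ((a y - a x) * b x + a x * (b x - b y)) * ((b x)^-1 * (b y)^-1).
  by field; rewrite nx ny.
rewrite normrM [leRHS]mulrAC; apply: ler_pM => //.
  rewrite [leRHS]mulrDl (le_trans (ler_normD _ _)) // !normrM; apply: lerD.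
    rewrite mulrC -mulrA; apply: ler_pM => //; first exact: Bb.
    by rewrite distrC.
  by rewrite -mulrA; apply: ler_pM => //; exact: Ba.
rewrite normrM expr2 !normfV; apply: ler_pM => //.
  by rewrite -[c]invrK lef_pV2 // posrE ?normr_gt0 // invr_gt0.
by rewrite -[c]invrK lef_pV2 // posrE ?normr_gt0 // invr_gt0.
Qed.

Lemma upd_invariant_cst p x y : (forall x u t, p (upd x u t) = p x) -> p x = p y.
Proof.
move=> h; pose z s := foldr (fun u z => upd z u (y u)) x s.
have -> : y = z (enum J).
  apply/funext => u; have : u \in enum J by rewrite mem_enum.
  rewrite /z; elim: (enum J) => //= w s IH; rewrite inE /upd.
  by case: eqP => [->|].
by rewrite /z; elim: (enum J) => //= u s ->; rewrite h.
Qed.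

(** Induction on the size of a set [V] containing every variable on which [p] depends. The slope [b]
    in a variable [v] of [V] does not depend on [v]. If [b] is not identically 0, the zero set
    splits into the graph part and zeros of [b]; otherwise [p] itself does not depend on [v]. *)
Lemma rnull_multi_affine p (v0 : J) x0 :
  multi_affine p -> loc_lip p -> p x0 <> 0 -> rnull (fun x => p x = 0).
Proof.
have [V hV] : exists V : {set J}, forall x u t, u \notin V -> p (upd x u t) = p x.
  by exists [set: J]%SET => x u t; rewrite inE.
move: {2}#|V| (leqnn #|V|) => N; elim: N V p hV x0 => [|N IH] V p hV x0 VN ap lp px0.
  apply: (rnull_pred0 v0) => x px; apply: px0; rewrite -px; apply: upd_invariant_cst.
  by move=> y u t; apply: hV; move: VN; rewrite leqn0 cards_eq0 => /eqP ->; rewrite inE.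
have [V0|[v vV]] := set_0Vmem V.
  by apply: (IH V p hV x0) => //; rewrite V0 cards0.
have VvN : (#|V :\ v| <= N)%N by rewrite -ltnS (leq_trans _ VN) // [leqRHS](cardsD1 v) vV.
pose b x := p (upd x v 1) - p (upd x v 0).
have ab : multi_affine b by apply: multi_affineB; exact: multi_affine_upd.
have lb : loc_lip b by apply: loc_lipD; [|apply: loc_lipN]; exact: loc_lip_upd.
have [[x1 bx1]|b0] := pselect (exists x, b x <> 0).
  apply: (@rnull_sub _ _ (fun x => (p x = 0 /\ b x <> 0) \/ b x = 0)).
    by move=> x px; have [bx|/eqP bx] := eqVneq (b x) 0; [right|left].
  apply: (rnullU v0); first exact: rnull_slope.
  apply: (IH (V :\ v) b _ x1) => // x u t; rewrite !inE negb_and negbK => /orP[/eqP ->|uV].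
    by rewrite /b !upd_upd.
  have [->|uv] := eqVneq u v; first by rewrite /b !upd_upd.
  by rewrite /b !(upd_comm _ _ _ uv) !(hV _ _ _ uV).
apply: (IH (V :\ v) p _ x0) => // x u t; rewrite !inE negb_and negbK => /orP[/eqP ->|];
  last exact: hV.
have pv z s : p (upd z v s) = p (upd z v 0).
  rewrite ap -/(b z); have [->|/eqP bz] := eqVneq (b z) 0; first by rewrite mulr0 addr0.
  by case: b0; exists z.
by rewrite pv -(pv x (x v)) upd_id.
Qed.
End MultiAffine.

(** * Passage to complex coordinates and determinants *)

Section ComplexNull.
Variables (I : finType) (n s : nat).
Local Notation C := (R[i]).
Local Notation J := (I * bool)%type.
Implicit Types (y : J -> R) (g : (J -> R) -> C).

(** The tag [true] marks real parts and [false] imaginary parts. *)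
Definition cplx y : I -> C := fun i => (y (i, true) +i* y (i, false))%C.

Lemma cnull_real (E : (I -> C) -> Prop) : rnull (fun y => E (cplx y)) -> cnull E.
Proof.
move=> nE eps /nE[lo [hi [h1 h2 h3]]].
exists (fun p => cplx (lo p)), (fun p => cplx (hi p)); split.
- by move=> p i; split; exact: h1.
- move=> x Ex; pose y (j : J) := if j.2 then complex.Re (x j.1) else complex.Im (x j.1).
  have xy : x = cplx y by apply/funext => i; rewrite /cplx /y /=; case: (x i).
  rewrite xy in Ex; have [p hp] := h2 _ Ex; exists p => i.
  by split; [exact: (hp (i, true))|exact: (hp (i, false))].
- move=> N; apply: le_trans (h3 N); rewrite le_eqVlt; apply/orP; left; apply/eqP.
  apply: eq_bigr => p _; rewrite /boxvol.
  transitivity (\prod_(i : I) \prod_(b : bool) (hi p (i, b) - lo p (i, b))).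
    by apply: eq_bigr => i _; rewrite big_bool.
  by rewrite pair_bigA /=; apply: eq_bigr => -[].
Qed.

Definition cloc_lip g : Prop :=
  loc_lip (fun y => complex.Re (g y)) /\ loc_lip (fun y => complex.Im (g y)).

Lemma cloc_lip_cst (c : C) : cloc_lip (fun=> c).
Proof. by split; exact: loc_lip_cst. Qed.

Lemma cloc_lip_conj_var i : cloc_lip (fun y => conjc (cplx y i)).
Proof. by split; [|apply: loc_lipN]; exact: loc_lip_var. Qed.

Lemma ReD (a b : C) : complex.Re (a + b) = complex.Re a + complex.Re b.
Proof. by case: a b => [? ?] [? ?]. Qed.

Lemma ImD (a b : C) : complex.Im (a + b) = complex.Im a + complex.Im b.
Proof. by case: a b => [? ?] [? ?]. Qed.

Lemma ReM (a b : C) : complex.Re (a * b) =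
  complex.Re a * complex.Re b - complex.Im a * complex.Im b.
Proof. by case: a b => [? ?] [? ?]. Qed.

Lemma ImM (a b : C) : complex.Im (a * b) =
  complex.Re a * complex.Im b + complex.Im a * complex.Re b.
Proof. by case: a b => [? ?] [? ?]. Qed.

Lemma cloc_lipD g1 g2 : cloc_lip g1 -> cloc_lip g2 -> cloc_lip (fun y => g1 y + g2 y).
Proof.
move=> [r1 i1] [r2 i2]; split.
  by rewrite (funext (fun y => ReD (g1 y) (g2 y))); exact: loc_lipD.
by rewrite (funext (fun y => ImD (g1 y) (g2 y))); exact: loc_lipD.
Qed.

Lemma cloc_lipM g1 g2 : cloc_lip g1 -> cloc_lip g2 -> cloc_lip (fun y => g1 y * g2 y).
Proof.
move=> [r1 i1] [r2 i2]; split.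
  rewrite (funext (fun y => ReM (g1 y) (g2 y))).
  by apply: loc_lipD; [|apply: loc_lipN]; exact: loc_lipM.
rewrite (funext (fun y => ImM (g1 y) (g2 y))).
by apply: loc_lipD; exact: loc_lipM.
Qed.

Lemma eq_cloc_lip g1 g2 : g1 =1 g2 -> cloc_lip g1 -> cloc_lip g2.
Proof. by move/funext => ->. Qed.

Lemma cloc_lip_sum (T : Type) (r : seq T) (F : T -> (J -> R) -> C) :
  (forall t, cloc_lip (F t)) -> cloc_lip (fun y => \sum_(t <- r) F t y).
Proof.
move=> h; elim: r => [|t r IH].
  by apply: eq_cloc_lip (cloc_lip_cst 0) => y; rewrite big_nil.
by apply: eq_cloc_lip (cloc_lipD (h t) IH) => y; rewrite big_cons.
Qed.

Lemma cloc_lip_prod (T : Type) (r : seq T) (F : T -> (J -> R) -> C) :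
  (forall t, cloc_lip (F t)) -> cloc_lip (fun y => \prod_(t <- r) F t y).
Proof.
move=> h; elim: r => [|t r IH].
  by apply: eq_cloc_lip (cloc_lip_cst 1) => y; rewrite big_nil.
by apply: eq_cloc_lip (cloc_lipM (h t) IH) => y; rewrite big_cons.
Qed.

Definition cmulti_affine g : Prop := forall y j t,
  g (upd y j t) = g (upd y j 0) + (t%:C)%C * (g (upd y j 1) - g (upd y j 0)).

(** At [x0] the real or the imaginary part is nonzero, and the zero set lies in the zero set of that
    part. *)
Lemma rnull_cmulti_affine (E : (I -> C) -> C) (i0 : I) (x0 : I -> C) :
  cloc_lip (fun y => E (cplx y)) -> cmulti_affine (fun y => E (cplx y)) ->
  E x0 <> 0 -> rnull (fun y => E (cplx y) = 0).
Proof.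
move=> [lr li] aff Ex0.
pose y0 (j : J) := if j.2 then complex.Re (x0 j.1) else complex.Im (x0 j.1).
have xy : x0 = cplx y0 by apply/funext => i; rewrite /cplx /y0 /=; case: (x0 i).
have ar : multi_affine (fun y => complex.Re (E (cplx y))).
  by move=> y j t; rewrite aff ReD ReM /= mul0r subr0 ReD; case: (E (cplx (upd y j 0))).
have ai : multi_affine (fun y => complex.Im (E (cplx y))).
  by move=> y j t; rewrite aff ImD ImM /= mul0r addr0 ImD; case: (E (cplx (upd y j 0))).
have [Er|/eqP Er] := eqVneq (complex.Re (E (cplx y0))) 0; last first.
  apply: rnull_sub (rnull_multi_affine (i0, true) ar lr Er) => y ->.
  by rewrite raddf0.
have Ei : complex.Im (E (cplx y0)) <> 0.
  by move=> Ei; apply: Ex0; rewrite xy; case: (E _) Er Ei => a b /= -> ->.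
apply: rnull_sub (rnull_multi_affine (i0, true) ai li Ei) => y ->.
by rewrite raddf0.
Qed.

(** Since [phi] is injective, each coordinate enters a single row, and the determinant is affine in
    it. It is not identically zero: at [x0] the matrix is [L], and $\det(LV)=1$. *)
Lemma rnull_det (i0 : I) (phi : 'I_s -> 'I_n -> I) (V : 'M[C]_(n, s)) (L : 'M[C]_(s, n)) :
  (forall a r a' r', phi a r = phi a' r' -> a = a' /\ r = r') -> L *m V = 1%:M ->
  rnull (fun y => \det ((\matrix_(a, r) conjc (cplx y (phi a r))) *m V) = 0).
Proof.
move=> phiI LV.
pose x0 i := if [pick c : 'I_s * 'I_n | phi c.1 c.2 == i] is Some c
             then conjc (L c.1 c.2) else 0.
apply: (@rnull_cmulti_affine (fun x => \det ((\matrix_(a, r) conjc (x (phi a r))) *m V)) i0 x0).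
- have h a c : cloc_lip (fun y => ((\matrix_(a, r) conjc (cplx y (phi a r))) *m V) a c).
    pose G r y : C := conjc (cplx y (phi a r)) * V r c.
    apply: (@eq_cloc_lip (fun y => \sum_r G r y)).
      by move=> y; rewrite mxE; apply: eq_bigr => r _; rewrite mxE.
    apply: cloc_lip_sum => r; apply: cloc_lipM; last exact: cloc_lip_cst.
    exact: cloc_lip_conj_var.
  apply: cloc_lip_sum => sg; apply: cloc_lipM; first exact: cloc_lip_cst.
  by apply: cloc_lip_prod => a; exact: h.
- move=> y [i b] t /=.
  pose F t : 'M[C]_(s, n) := \matrix_(a, r) conjc (cplx (upd y (i, b) t) (phi a r)).
  rewrite -![\matrix_(a, r) _]/(F _).
  have Fi a r u : phi a r != i -> F u a r = F 0 a r.
    by move=> ne; rewrite !mxE /cplx /upd !xpair_eqE (negPf ne).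
  suff -> : \det (F t *m V) = (1 - t%:C%C) * \det (F 0 *m V) + t%:C%C * \det (F 1 *m V).
    by ring.
  (* If the coordinate occurs in row [a], the other rows are fixed; if it occurs nowhere, all three
     matrices agree. *)
  have [/existsP[a /existsP[r0 /eqP ar0]]|/existsPn no] :=
      boolP [exists a, exists r, phi a r == i]; last first.
    have Fc u : F u = F 0.
      by apply/matrixP => a r; apply: Fi; move: (no a) => /existsPn.
    by rewrite !Fc; ring.
  have Fr u v : row' a (F u *m V) = row' a (F v *m V).
    apply/matrixP => a' c; rewrite !mxE; apply: eq_bigr => r _.
    have ne : phi (lift a a') r != i.
      by rewrite -ar0; apply/eqP => /phiI[/eqP]; rewrite eq_sym (negPf (neq_lift _ _)).
    by rewrite !(Fi _ _ _ ne).
  apply: (@determinant_multilinear _ _ _ _ _ a).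
  + apply/rowP => c; rewrite !mxE !mulr_sumr -big_split /=; apply: eq_bigr => r _.
    have [ari|ne] := eqVneq (phi a r) i; last by rewrite !(Fi _ _ _ ne); ring.
    rewrite !mxE ari /cplx /upd !xpair_eqE !eqxx /=.
    by case: (b) => /=; case: (V r c) => vr vi; congr Complex; simpl; ring.
  + exact: Fr.
  + exact: Fr.
- suff -> : (\matrix_(a, r) conjc (x0 (phi a r))) = L.
    by rewrite LV det1; apply/eqP; exact: oner_neq0.
  apply/matrixP => a r; rewrite mxE /x0; case: pickP => [[a' r'] /= /eqP /phiI[-> ->]|].
    by rewrite conjcK.
  by move=> /(_ (a, r)); rewrite eqxx.
Qed.
End ComplexNull.
End NullSets.

(** * The generalized eigenspace and the characteristic polynomial *)

Section CharPoly.
Variable F : fieldType.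

Lemma char_poly_tr n (A : 'M[F]_n) : char_poly A^T = char_poly A.
Proof.
rewrite /char_poly -[RHS]det_tr /char_poly_mx; congr (\det _).
by rewrite linearB /= tr_scalar_mx map_trmx.
Qed.

Lemma char_poly_intertwine n (P M T : 'M[F]_n) :
  P \in unitmx -> P *m M = T *m P -> char_poly M = char_poly T.
Proof.
move=> uP PM; pose P' := map_mx (@polyC F) P.
have uP' : \det P' != 0.
  by rewrite det_map_mx polyC_eq0 -unitfE -unitmxE.
apply: (mulfI uP'); rewrite /char_poly [RHS]mulrC -!det_mulmx; congr (\det _).
rewrite /char_poly_mx mulmxBr mulmxBl -!map_mxM PM.
by rewrite mul_mx_scalar mul_scalar_mx.
Qed.

Lemma char_poly_lblock s t (T1 : 'M[F]_s) (T3 : 'M[F]_(t, s)) (T2 : 'M[F]_t) :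
  char_poly (block_mx T1 0 T3 T2) = char_poly T1 * char_poly T2.
Proof.
rewrite /char_poly -(@det_lblock _ _ _ _ (- map_mx (@polyC F) T3)); congr (\det _).
rewrite /char_poly_mx map_block_mx map_mx0 scalar_mx_block opp_block_mx add_block_mx.
by rewrite oppr0 addr0 add0r.
Qed.

(** In the row basis formed by [U] and [W], [M] becomes block lower triangular. The equation $n=s+t$
    is substituted to make the stacked matrix square. *)
Lemma char_poly_stable n s t (M : 'M[F]_n) (U : 'M[F]_(s, n)) (W : 'M[F]_(t, n))
    (T1 : 'M[F]_s) (T3 : 'M[F]_(t, s)) (T2 : 'M[F]_t) :
  n = (s + t)%N -> row_full (col_mx U W) ->
  U *m M = T1 *m U -> W *m M = T3 *m U + T2 *m W ->
  char_poly M = char_poly T1 * char_poly T2.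
Proof.
move=> e; subst n => full UM WM.
rewrite -(char_poly_lblock T1 T3 T2); apply: (@char_poly_intertwine _ (col_mx U W)).
  by rewrite -row_full_unit.
by rewrite mul_col_mx UM WM mul_block_col mul0mx addr0.
Qed.

(** With $N=T-\lambda I$, the matrix $(X-\lambda)^kI=(X-\lambda)^kI-N^k$ is a multiple of $XI-T$.
    Taking determinants, the characteristic polynomial divides a power of $X-\lambda$; it is monic
    of degree [s]. *)
Lemma char_poly_nilpotent s k (T : 'M[F]_s) lam :
  (T - lam%:M) ^+ k = 0 -> char_poly T = ('X - lam%:P) ^+ s.
Proof.
move=> nT.
have dv : char_poly T %| ('X - lam%:P) ^+ (k * s)%N.
  pose X : 'M[{poly F}]_s := ('X - lam%:P)%:M; pose N := map_mx (@polyC F) (T - lam%:M).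
  have cXN : GRing.comm X N by rewrite /GRing.comm -!mulmxE mul_mx_scalar mul_scalar_mx.
  have eX : X - N = char_poly_mx T.
    rewrite /X /N /char_poly_mx map_mxB map_scalar_mx raddfB /=.
    by rewrite opprB addrA subrK.
  have Nk : N ^+ k = 0.
    rewrite -[RHS](map_mx0 (@polyC F)) -nT /N.
    elim: k {nT} => [|k IH]; first by rewrite !expr0 map_mx1.
    by rewrite !exprS -!mulmxE map_mxM IH.
  have Xk : X ^+ k = (('X - lam%:P) ^+ k)%:M.
    rewrite /X; elim: k {nT Nk} => [|k IH]; first by rewrite !expr0.
    by rewrite !exprS IH -mulmxE -scalar_mxM.
  have := congr1 determinant (subrXX_comm k cXN).
  rewrite Nk subr0 Xk eX det_scalar -exprM -mulmxE det_mulmx => ->.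
  exact: dvdp_mulr.
have [j _ ej] := dvdp_exp_XsubCP dv.
have mX i : ('X - lam%:P) ^+ i \is monic by rewrite monic_exp // monicXsubC.
move: ej; rewrite eqp_monic ?char_poly_monic // => /eqP ej.
have := size_char_poly T; rewrite ej size_exp_XsubC => -[<-].
by [].
Qed.

Lemma exp_intertwine s n (U : 'M[F]_(s, n)) N D k :
  U *m N = D *m U -> U *m N ^+ k = D ^+ k *m U.
Proof.
move=> UN; elim: k => [|k IH]; first by rewrite !expr0 mulmx1 mul1mx.
by rewrite !exprS -!mulmxE mulmxA UN -mulmxA IH mulmxA.
Qed.

(** The rows of [U] span the generalized eigenspace [K], those of [W] a complement. The
    characteristic polynomial factors accordingly: the first factor is $(X-\lambda)^{\dim K}$, the
    second does not vanish at $\lambda$. *)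
Lemma mup_char_poly n k (M : 'M[F]_n) lam :
  (forall u : 'rV_n, u *m (M - lam%:M) ^+ k.+1 = 0 -> u *m (M - lam%:M) ^+ k = 0) ->
  mup lam (char_poly M) = \rank (kermx ((M - lam%:M) ^+ k)).
Proof.
set N := M - lam%:M => stab; pose K := kermx (N ^+ k).
pose U := row_base K; pose W := row_base (complmx K).
have NM p (V : 'M[F]_(p, n)) : V *m M = V *m N + lam *: V.
  by rewrite /N mulmxBr mul_mx_scalar subrK.
have Kst : (K *m N <= K)%MS.
  apply/sub_kermxP; rewrite -mulmxA mulmxE -exprS exprSr -mulmxE mulmxA.
  by rewrite mulmx_ker mul0mx.
have UK : (U :=: K)%MS by exact: eq_row_base.
have WK : (W :=: complmx K)%MS by exact: eq_row_base.
have /submxP[D UN] : (U *m N <= U)%MS.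
  by rewrite UK; apply: submx_trans Kst; rewrite submxMr // UK.
have full : row_full (col_mx U W).
  rewrite -sub1mx -addsmxE.
  have : (1%:M <= K + complmx K)%MS by rewrite sub1mx addsmx_compl_full.
  by move/submx_trans; apply; apply: addsmxS; rewrite ?UK ?WK.
have /submxP[T WT] : (W *m N <= col_mx U W)%MS by exact: submx_full.
have e : n = (\rank K + \rank (complmx K))%N by rewrite mxrank_compl subnKC // rank_leq_row.
have WM : W *m M = lsubmx T *m U + (rsubmx T + lam%:M) *m W.
  by rewrite NM WT -{1}[T]hsubmxK mul_row_col mulmxDl mul_scalar_mx addrA.
have UM : U *m M = (D + lam%:M) *m U by rewrite NM UN mulmxDl mul_scalar_mx.
have rfU : row_free U by exact: row_base_free.
have rfW : row_free W by exact: row_base_free.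
rewrite (char_poly_stable e full UM WM) (@char_poly_nilpotent _ k _ lam); last first.
  rewrite addrK; apply: (row_free_inj rfU); rewrite mul0mx.
  rewrite -(exp_intertwine _ UN); apply/sub_kermxP; rewrite -/K.
  by rewrite UK.
(* If [u] is an eigenvector of the second block for [lam], then $uWN$ lies in [K], so by stability
   $uW$ lies in [K] as well as in its complement, and $u=0$. *)
rewrite mupMl ?mup_XsubCX ?eqxx // -eigenvalue_root_char.
apply/negP => /eigenvalueP[u].
rewrite mulmxDr mul_mx_scalar => /(canRL (addrK _)); rewrite subrr => uT.
apply/negP; rewrite negbK; apply/eqP.
apply: (row_free_inj rfW); rewrite mul0mx.
have uWK : (u *m W <= K)%MS.
  apply/sub_kermxP; apply: stab; rewrite exprS -mulmxE mulmxA -(mulmxA u W N) WT.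
  rewrite -[T]hsubmxK mul_row_col mulmxDr [u *m (rsubmx T *m W)]mulmxA uT mul0mx addr0.
  apply/sub_kermxP; rewrite -/K; apply: submx_trans (submxMl _ _) _.
  by apply: submx_trans (submxMl _ _) _; rewrite UK.
apply/eqP; rewrite -submx0 -(capmx_compl K) sub_capmx uWK /=.
by apply: submx_trans (submxMl _ _) _; rewrite WK.
Qed.
End CharPoly.

(** * Weyr characteristic and block indices *)

Section Blocks.
Implicit Types (w : nat -> nat).

Lemma mu0 w : mu w 0 = 0%N.
Proof. by rewrite /mu big_geq. Qed.

Lemma muS w l : mu w l.+1 = (mu w l + w l.+1)%N.
Proof. by rewrite /mu big_nat_recr. Qed.

Lemma leq_mu w l l' : (l <= l')%N -> (mu w l <= mu w l')%N.
Proof.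
move=> /subnKC <-; elim: (l' - l)%N => [|p IH]; first by rewrite addn0.
by rewrite addnS muS (leq_trans IH) // leq_addr.
Qed.

(** The bounds [mu w l] do not decrease with [l], so those not exceeding [j] form an initial
    segment, whose length is [blk w k j]. *)
Lemma blk_ltE w k j l : (l <= k)%N -> (blk w k j < l)%N = (j < mu w l)%N.
Proof.
move=> lk; rewrite /blk (@big_cat_nat _ _ _ l.+1) ?ltnS //=.
have [jl|lj] := ltnP j (mu w l).
  case: l lk jl => [|l] lk jl; first by rewrite mu0 in jl.
  rewrite [X in (_ + X)%N]big1_seq ?addn0; last first.
    move=> l' /andP[_]; rewrite mem_index_iota => /andP[ll' _].
    by rewrite leqNgt (leq_trans jl) // leq_mu // ltnW.
  rewrite big_nat_recr //= [(mu w l.+1 <= j)%N]leqNgt jl addn0 ltnS.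
  rewrite -[leqRHS](subn1 l.+1) -[leqRHS]muln1 -sum_nat_const_nat leq_sum // => l' _.
  exact: leq_b1.
rewrite ltnNge; apply/negbF; apply: leq_trans (leq_addr _ _).
rewrite -[leqLHS](subn1 l.+1) -[leqLHS]muln1 -sum_nat_const_nat.
rewrite big_nat_cond [leqRHS]big_nat_cond leq_sum // => l' /andP[/andP[_ l'l] _].
by rewrite (leq_trans _ lj) // leq_mu.
Qed.

(** The b-conditions on column [i] continue the c-conditions $j\le i$ up to the end of the block,
    which gives [mu w (blk w k i).+1] conditions in all. *)
Lemma PhiE w k i j : (blk w k i < k)%N ->
  Phi w k i j = (i < j < mu w (blk w k i).+1)%N.
Proof.
move=> ik; rewrite /Phi andbC; case: ltnP => //= ij.
rewrite -(blk_ltE _ _ ik) ltnS eqn_leq andbC; case: leqP => //= _.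
rewrite leqNgt (blk_ltE _ _ (ltnW ik)) -leqNgt (leq_trans _ (ltnW ij)) //.
by rewrite leqNgt -(blk_ltE _ _ (ltnW ik)) ltnn.
Qed.
End Blocks.

(** * Kernels of powers and algebraic multiplicity *)

Section Kernels.
Variables (R : realType) (n : nat).
Local Notation C := (R[i]).
Implicit Types (N : 'M[C]_n) (v : 'cV[C]_n).

Lemma tr_exp N l : (N ^+ l)^T = N^T ^+ l.
Proof.
elim: l => [|l IH]; first by rewrite !expr0 trmx1.
by rewrite exprS exprSr -!mulmxE trmx_mul IH.
Qed.

Lemma ker_rowE N v : (v^T <= kermx N^T)%MS <-> N *m v = 0.
Proof.
split => [/sub_kermxP|h]; last by apply/sub_kermxP; rewrite -trmx_mul h trmx0.
by rewrite -trmx_mul => /(congr1 trmx); rewrite trmxK trmx0.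
Qed.

Lemma ker_exp_le N v l l' : (l <= l')%N -> N ^+ l *m v = 0 -> N ^+ l' *m v = 0.
Proof. by move=> /subnK <- h; rewrite exprD -mulmxE -mulmxA h mulmx0. Qed.

Lemma ker_exp_sub N l l' : (l <= l')%N -> (kermx (N ^+ l)^T <= kermx (N ^+ l')^T)%MS.
Proof.
move=> /subnKC <-; apply/sub_kermxP.
by rewrite addnC exprD -mulmxE trmx_mul mulmxA mulmx_ker mul0mx.
Qed.

Lemma leq_dimker N l : (dimker (N ^+ l) <= dimker (N ^+ l.+1))%N.
Proof. by apply: mxrankS; apply: ker_exp_sub. Qed.

(** The sum telescopes; truncated subtraction is exact because the kernels are nested. *)
Lemma mu_weyr A (lam : C) l : mu (weyr A lam) l = dimker ((A - lam%:M) ^+ l : 'M[C]_n).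
Proof.
elim: l => [|l IH]; first by rewrite mu0 /dimker expr0 trmx1 mxrank_ker mxrank1 subnn.
rewrite muS IH /weyr; apply: subnKC; exact: leq_dimker.
Qed.

Lemma weyr_stable A (lam : C) k v : weyr A lam k.+1 = 0%N ->
  (A - lam%:M) ^+ k.+1 *m v = 0 -> (A - lam%:M) ^+ k *m v = 0.
Proof.
move=> /eqP; rewrite /weyr subn_eq0 => le /ker_rowE h; apply/ker_rowE.
apply: submx_trans h _.
have := mxrank_leqif_sup (ker_exp_sub (A - lam%:M) (leqnSn k)).
by move=> [_ <-]; rewrite eqn_leq [X in _ && X]le andbT; exact: leq_dimker.
Qed.

(** Transposition passes from column kernels to the row kernels of [mup_char_poly]. *)
Lemma mu_mup A (lam : C) k : weyr A lam k.+1 = 0%N ->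
  mu (weyr A lam) k = mup lam (char_poly (A : 'M[C]_n)).
Proof.
move=> wk; rewrite mu_weyr /dimker tr_exp linearB /= tr_scalar_mx -char_poly_tr.
rewrite (@mup_char_poly _ _ k) // => u h.
have E l : u *m (A^T - lam%:M) ^+ l = ((A - lam%:M) ^+ l *m u^T)^T.
  by rewrite trmx_mul trmxK tr_exp linearB /= tr_scalar_mx.
move: h; rewrite !E => /(congr1 trmx); rewrite trmxK trmx0 => /(weyr_stable wk) ->.
by rewrite trmx0.
Qed.
End Kernels.

(** * The staircase system *)

Section Solve.
Variables (R : realType) (n m k : nat) (A : 'M[R[i]]_n) (lam : R[i]).
Local Notation C := (R[i]).
Local Notation w := (weyr A lam).
Local Notation N := (A - lam%:M).
Local Notation blk := (blk w k).
Hypothesis mu_k : mu w k = m.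
Hypothesis stable : forall v : 'cV[C]_n, N ^+ k.+1 *m v = 0 -> N ^+ k *m v = 0.
Implicit Types (B Cm Y Z : 'M[C]_(n, m)) (S T : 'M[C]_m) (v : 'cV[C]_n).

Lemma blk_lt (i : 'I_m) : (blk i < k)%N.
Proof. by rewrite blk_ltE // mu_k. Qed.

Lemma mu_le l : (l <= k)%N -> (mu w l <= m)%N.
Proof. by rewrite -mu_k; exact: leq_mu. Qed.

Lemma hdotE p q r (X : 'M[C]_(p, q)) (V : 'M[C]_(p, r)) i j :
  hdot (col j X) (col i V) = ((map_mx conjc X)^T *m V) j i.
Proof. by rewrite /hdot mxE; apply: eq_bigr => a _; rewrite !mxE. Qed.

(** The right-hand side [e] is a Kronecker delta for the system itself and 0 for differences of
    solutions and for the linearization. *)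
Definition conds B Cm (i : 'I_m) v (e : 'I_m -> C) : Prop :=
  (forall j : 'I_m, (j <= i)%N -> hdot (col j Cm) v = e j) /\
  (forall j : 'I_m, Phi w k i j -> hdot (col j B) v = 0).

Definition generic B Cm (i : 'I_m) : Prop :=
  (forall v, N ^+ (blk i).+1 *m v = 0 -> conds B Cm i v (fun=> 0) -> v = 0) /\
  (exists v, N ^+ (blk i).+1 *m v = 0 /\ conds B Cm i v (fun j => (i == j)%:R)).

Local Notation I := (('I_n * 'I_m) + ('I_n * 'I_m))%type.

(** On a basis [V] of the kernel the conditions form a square system with matrix [F x *m V]; the
    exceptional set is the zero set of its determinant. *)
Lemma rnull_not_generic (i0 : I) (i : 'I_m) :
  exists E : (I -> C) -> Prop, rnull (fun y => E (cplx y)) /\ forall x, ~ E x ->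
    generic (\matrix_(r, j) x (inl (r, j))) (\matrix_(r, j) x (inr (r, j))) i.
Proof.
pose l := (blk i).+1; pose K := kermx (N ^+ l)^T; pose s := \rank K.
have es : s = mu w l by rewrite mu_weyr.
have sm : (s <= m)%N by rewrite es mu_le // blk_lt.
pose V := (row_base K)^T.
have [L LV] : exists L, L *m V = 1%:M.
  have /row_freeP[L KL] := row_base_free K.
  by exists L^T; rewrite -trmx_mul KL trmx1.
pose wd (a : 'I_s) : 'I_m := widen_ord sm a.
(* Row [a] comes from $c_a$ for $a\le i$ and from $b_a$ for $i<a$; in [x] the b's sit on the left
   and the c's on the right. *)
pose phi (a : 'I_s) (r : 'I_n) : I := if (a <= i)%N then inr (r, wd a) else inl (r, wd a).
have phiI a r a' r' : phi a r = phi a' r' -> a = a' /\ r = r'.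
  by rewrite /phi; case: ifP => _; case: ifP => _ [] // -> /ord_inj.
pose F x : 'M[C]_(s, n) := \matrix_(a, r) conjc (x (phi a r)).
exists (fun x => \det (F x *m V) = 0); split; first exact: (rnull_det i0 phiI LV).
move=> x /eqP dx; set B := \matrix_(_, _) _; set Cm := \matrix_(_, _) x (inr _).
have FvE v a : (F x *m v) a 0 = hdot (col (wd a) (if (a <= i)%N then Cm else B)) v.
  by rewrite mxE; apply: eq_bigr => r _; rewrite !mxE /phi; case: ifP; rewrite mxE.
have FV : F x *m V \in unitmx by rewrite unitmxE unitfE.
have VK (u : 'cV_s) : N ^+ l *m (V *m u) = 0.
  apply/ker_rowE; rewrite trmx_mul trmxK; apply: submx_trans (submxMl _ _) _.
  by rewrite eq_row_base.
have ki : (blk i < k)%N by exact: blk_lt.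
split.
- move=> v /ker_rowE vK [hC hB].
  have /submxP[u vu] : (v^T <= row_base K)%MS by rewrite eq_row_base.
  have vV : v = V *m u^T by rewrite -[LHS]trmxK vu trmx_mul.
  suff : F x *m v = 0.
    rewrite vV mulmxA => /(congr1 (mulmx (invmx (F x *m V)))).
    by rewrite mulKmx // mulmx0 => ->; rewrite mulmx0.
  apply/colP => a; rewrite FvE [RHS]mxE; case: leqP => ai; first exact: hC.
  by apply: hB; rewrite PhiE //= ai /= -es.
- pose e : 'cV[C]_s := \col_a (i == wd a)%:R.
  exists (V *m (invmx (F x *m V) *m e)); split; first exact: VK.
  set v := V *m _; have Fv : F x *m v = e by rewrite /v !mulmxA mulmxV ?mul1mx.
  have is_ (j : nat) : (j < s)%N = (j < mu w l)%N by rewrite es.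
  have ils : (i < s)%N by rewrite is_ -(blk_ltE _ _ ki) ltnSn.
  split=> j.
  + move=> ji; have js := leq_ltn_trans ji ils.
    have := FvE v (Ordinal js); rewrite Fv mxE /= ji.
    by have -> : wd (Ordinal js) = j by exact: val_inj.
  + rewrite PhiE // => /andP[ij jl]; have js : (j < s)%N by rewrite is_.
    have := FvE v (Ordinal js); rewrite Fv mxE /= leqNgt ij /=.
    have -> : wd (Ordinal js) = j by exact: val_inj.
    by move=> <-; rewrite -(inj_eq val_inj) /= ltn_eqF.
Qed.

(** * Existence, uniqueness and linearization for fixed b and c *)

Section Fixed.
Variables (B Cm : 'M[C]_(n, m)).

Lemma left_inverse Y :
  (forall i j : 'I_m, (j <= i)%N -> hdot (col j Cm) (col i Y) = (i == j)%:R) ->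
  exists X : 'M[C]_(m, n), X *m Y = 1%:M.
Proof.
move=> h; set P := (map_mx conjc Cm)^T.
have PY (j i : 'I_m) : (j <= i)%N -> (P *m Y) j i = (i == j)%:R.
  by move=> ji; rewrite -hdotE h.
have uP : P *m Y \in unitmx.
  rewrite unitmxE unitfE det_trig; last first.
    by apply/is_trig_mxP => j i ji; rewrite PY ?(ltnW ji) // -val_eqE gtn_eqF.
  by apply/prodf_neq0 => j _; rewrite PY // eqxx oner_neq0.
by exists (invmx (P *m Y) *m P); rewrite -mulmxA mulVmx.
Qed.

(** The first [mu w l] columns of [Y] lie in the kernel of $N^l$ and are independent because of [X];
    their number is its dimension. *)
Lemma span_ker Y X l v : X *m Y = 1%:M ->
  (forall i : 'I_m, N ^+ (blk i).+1 *m col i Y = 0) -> (l <= k)%N -> N ^+ l *m v = 0 ->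
  exists2 a : 'cV[C]_m, (forall j : 'I_m, (mu w l <= j)%N -> a j 0 = 0) & v = Y *m a.
Proof.
move=> XY Yk lk /ker_rowE vK; set s := mu w l.
have sm : (s <= m)%N by exact: mu_le.
(* [E] selects the first [s] rows, so the rows of [U] are the transposed columns of [Y] in the first
   [l] blocks. *)
pose E : 'M[C]_(s, m) := pid_mx s.
pose U := E *m Y^T.
have UK : (U <= kermx (N ^+ l)^T)%MS.
  apply/sub_kermxP; rewrite /U -mulmxA -trmx_mul.
  apply/matrixP => a r; rewrite !mxE big1 // => j _; rewrite [_^T _ _]mxE /E mxE.
  case: eqP => [aj|_]; last by rewrite mul0r.
  have jl : (blk j < l)%N by rewrite blk_ltE // -aj ltn_ord.
  have : (N ^+ l *m col j Y) r 0 = 0 by rewrite (ker_exp_le jl) // mxE.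
  by rewrite colE mulmxA -colE mxE => ->; rewrite mulr0.
have Ufree : row_free U.
  apply/row_freeP; exists (X^T *m E^T).
  rewrite /U mulmxA -(mulmxA E) -trmx_mul XY trmx1 mulmx1 /E tr_pid_mx mul_pid_mx minnn.
  by rewrite (minn_idPr sm) pid_mx_1.
have KU : (kermx (N ^+ l)^T <= U)%MS.
  have [_ <-] := mxrank_leqif_sup UK.
  by move/eqP: Ufree => ->; rewrite /s mu_weyr.
have /submxP[D vD] := submx_trans vK KU.
exists (D *m E)^T; last by rewrite -[v]trmxK vD /U mulmxA trmx_mul trmxK.
move=> j sj; rewrite !mxE big1 // => a _; rewrite /E mxE.
by rewrite (ltn_eqF (leq_trans (ltn_ord a) sj)) mulr0.
Qed.

Lemma col_mulmx p q r (X : 'M[C]_(p, q)) (V : 'M[C]_(q, r)) j :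
  col j (X *m V) = X *m col j V.
Proof. by rewrite !colE mulmxA. Qed.

(** Column [i] of a staircase matrix is supported on strictly earlier blocks. *)
Lemma staircase_col Z S (i : 'I_m) (M : 'M[C]_n) : staircase w k S ->
  (forall j : 'I_m, (blk j < blk i)%N -> M *m col j Z = 0) -> M *m col i (Z *m S) = 0.
Proof.
move=> stS h; rewrite col_mulmx mulmxA; apply/colP => r; rewrite mxE [RHS]mxE big1 // => j _.
rewrite [col i S j 0]mxE; have [/h|/stS ->] := ltnP (blk j) (blk i); last by rewrite mulr0.
by rewrite -col_mulmx => /colP /(_ r); rewrite mxE [RHS]mxE => ->; rewrite mul0r.
Qed.

(** Induction on the block: $Nz_i$ is a combination of columns from earlier blocks plus $q_i$, all
    killed by $N$ to the power [blk i]. [Q] is 0 for the system and reduces to $YT$ for the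
    linearization. *)
Lemma staircase_level Z Q S : staircase w k S -> N *m Z = Z *m S + Q ->
  (forall i : 'I_m, N ^+ (blk i) *m col i Q = 0) ->
  forall i : 'I_m, N ^+ (blk i).+1 *m col i Z = 0.
Proof.
move=> stS eZ hQ i; have [b] := ubnP (blk i); elim: b i => // b IH i; rewrite ltnS => ib.
rewrite exprSr -mulmxE -mulmxA -col_mulmx eZ linearD mulmxDr /= hQ addr0.
apply: staircase_col => // j ji; apply: (ker_exp_le ji).
by apply: IH; apply: leq_trans ji ib.
Qed.

(** A coarser version for an inhomogeneity known only to lie in the kernel of $N^k$, as is $\sigma
    Y$ before $\sigma=0$ is known. Stability absorbs the extra factor $N$. *)
Lemma staircase_gen_ker Z Q S : staircase w k S -> N *m Z = Z *m S + Q ->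
  (forall i, N ^+ k *m col i Q = 0) -> forall i, N ^+ k *m col i Z = 0.
Proof.
move=> stS eZ hQ i; have [b] := ubnP (blk i); elim: b i => // b IH i; rewrite ltnS => ib.
apply: stable; rewrite exprSr -mulmxE -mulmxA -col_mulmx eZ linearD mulmxDr /= hQ addr0.
by apply: staircase_col => // j ji; apply: IH; apply: leq_trans ji ib.
Qed.

Lemma conds_sub i v v' e e' : conds B Cm i v e -> conds B Cm i v' e' ->
  conds B Cm i (v - v') (fun j => e j - e' j).
Proof.
have hB (p : 'cV[C]_n) : hdot p (v - v') = hdot p v - hdot p v'.
  by rewrite /hdot -sumrB; apply: eq_bigr => r _; rewrite !mxE mulrBr.
move=> [h1 h2] [h1' h2']; split=> j hj; rewrite hB ?h1 ?h1' //.
by rewrite h2 // h2' // subrr.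
Qed.

Hypothesis gen : forall i, generic B Cm i.

(** Genericity provides the columns. Since $Ny_i$ is killed by $N$ to the power [blk i], it is a
    combination of columns from strictly earlier blocks; this gives both $NY=YS$ and the staircase
    shape. *)
Lemma system_exists : exists Y S X,
  [/\ X *m Y = 1%:M, staircase w k S, wsystem k A lam B Cm Y S
    & forall i : 'I_m, N ^+ (blk i).+1 *m col i Y = 0].
Proof.
have /fin_all_exists[f hf] : forall i : 'I_m, exists v,
    N ^+ (blk i).+1 *m v = 0 /\ conds B Cm i v (fun j => (i == j)%:R).
  by move=> i; case: (gen i).
pose Y : 'M[C]_(n, m) := \matrix_(r, i) f i r 0.
have colY i : col i Y = f i by apply/colP => r; rewrite !mxE.
have Yk (i : 'I_m) : N ^+ (blk i).+1 *m col i Y = 0 by rewrite colY; case: (hf i).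
have hC (i j : 'I_m) : (j <= i)%N -> hdot (col j Cm) (col i Y) = (i == j)%:R.
  by rewrite colY => ji; case: (hf i) => _ [h _]; exact: h.
have [X XY] := left_inverse hC.
pose S := X *m (N *m Y).
have Sa (i : 'I_m) : exists2 a : 'cV[C]_m, (forall j : 'I_m, (mu w (blk i) <= j)%N -> a j 0 = 0)
    & N *m col i Y = Y *m a /\ col i S = a.
  have h : N ^+ (blk i) *m (N *m col i Y) = 0 by rewrite mulmxA mulmxE -exprSr.
  have [a a0 ea] := span_ker XY Yk (ltnW (blk_lt i)) h.
  exists a => //; split=> //.
  by rewrite /S !col_mulmx ea mulmxA XY mul1mx.
exists Y, S, X; split=> //.
  move=> j i ij; have [a a0 [_ ea]] := Sa i.
  have <- : col i S j 0 = S j i by rewrite mxE.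
  by rewrite ea a0 // leqNgt -(blk_ltE _ _ (ltnW (blk_lt i))) -leqNgt.
split=> // [|i j ij]; last by rewrite colY; case: (hf i) => _ [_]; apply.
apply/matrixP => r i; have [a _ [ea eS]] := Sa i.
have : col i (N *m Y) = col i (Y *m S) by rewrite (col_mulmx N) (col_mulmx Y) ea eS.
by move/colP => /(_ r); rewrite mxE [RHS]mxE.
Qed.

(** The staircase shape of [S'] puts the columns of [Y'] into the kernels of their blocks, so each
    column of $Y'-Y$ solves the homogeneous square system. *)
Lemma system_unique Y S X Y' S' : X *m Y = 1%:M ->
  (forall i : 'I_m, N ^+ (blk i).+1 *m col i Y = 0) ->
  wsystem k A lam B Cm Y S ->
  staircase w k S' -> wsystem k A lam B Cm Y' S' -> Y' = Y /\ S' = S.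
Proof.
move=> XY Yk [eY cY bY] stS' [eY' cY' bY'].
have eYY : Y' = Y.
  suff h i : col i Y' = col i Y.
    by apply/matrixP => r i; move/colP: (h i) => /(_ r); rewrite mxE [RHS]mxE.
  apply/eqP; rewrite -subr_eq0; apply/eqP; apply: (gen i).1.
    rewrite mulmxBr Yk subr0; apply: (staircase_level (Q := 0) stS').
      by rewrite eY' addr0.
    by move=> j; rewrite linear0 mulmx0.
  have c1 : conds B Cm i (col i Y') (fun j => (i == j)%:R) by split=> j; [exact: cY'|exact: bY'].
  have c2 : conds B Cm i (col i Y) (fun j => (i == j)%:R) by split=> j; [exact: cY|exact: bY].
  by have [h1 h2] := conds_sub c1 c2; split=> // j /h1 ->; rewrite subrr.
split=> //; rewrite -[S']mul1mx -[S]mul1mx -XY -!mulmxA -eY -{1}eYY -eY'.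
by rewrite eYY.
Qed.

(** The order matters: [Z] is first placed only in the kernel of $N^k$, which suffices for $Z=YW$
    and the trace. Once $\sigma=0$, its columns descend to the kernels of their blocks, where
    genericity applies. *)
Lemma linearized_injective Y S X (sigma : C) Z T : (0 < m)%N -> X *m Y = 1%:M ->
  (forall i : 'I_m, N ^+ (blk i).+1 *m col i Y = 0) -> staircase w k S -> N *m Y = Y *m S ->
  staircase w k T ->
  N *m Z - sigma *: Y - Z *m S - Y *m T = 0 ->
  (forall i, conds B Cm i (col i Z) (fun=> 0)) ->
  [/\ sigma = 0, Z = 0 & T = 0].
Proof.
move=> m0 XY Yk stS eY stT eq0 cZ.
have eZ : N *m Z = Z *m S + (sigma *: Y + Y *m T).
  by apply/eqP; rewrite -subr_eq0 -[X in _ == X]eq0 !opprD !addrA (addrAC _ (- (Z *m S))).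
have Yk' i : N ^+ k *m col i Y = 0 by apply: ker_exp_le (Yk i); exact: blk_lt.
have Zk : forall i, N ^+ k *m col i Z = 0.
  apply: (staircase_gen_ker stS eZ) => i.
  rewrite linearD linearZ /= mulmxDr -scalemxAr Yk' scaler0 add0r.
  by apply: staircase_col.
have [W ZW] : exists W, Z = Y *m W.
  have /fin_all_exists[f hf] : forall i : 'I_m, exists a, col i Z = Y *m a.
    by move=> i; have [a _ ea] := span_ker XY Yk (leqnn k) (Zk i); exists a.
  exists (\matrix_(j, i) f i j 0); apply/matrixP => r i.
  have := hf i => /colP /(_ r); rewrite mxE => ->; rewrite !mxE.
  by apply: eq_bigr => j _; rewrite mxE.
have sig0 : sigma = 0.
  (* After multiplication by [X] the equation reads $SW=WS+\sigma I+T$. The traces of $SW$ and $WS$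
     agree and [T] has zero diagonal, so $m\sigma=0$. *)
  have : \tr (X *m (N *m Z)) = \tr (X *m (Z *m S + (sigma *: Y + Y *m T))) by rewrite eZ.
  rewrite {1}ZW (mulmxA N) eY -(mulmxA Y) (mulmxA X) XY mul1mx ZW !mulmxDr !mulmxA -scalemxAr XY.
  rewrite !mul1mx !mxtraceD mxtraceZ mxtrace1 (mxtrace_mulC W S) => /eqP.
  have -> : \tr T = 0 by rewrite /mxtrace big1 // => i _; apply: stT.
  rewrite addr0 -subr_eq0 opprD addrA subrr add0r oppr_eq0 mulf_eq0 pnatr_eq0.
  by rewrite (gtn_eqF m0) orbF => /eqP.
have Z0 : Z = 0.
  suff h i : col i Z = 0 by apply/matrixP => r i; move/colP: (h i) => /(_ r); rewrite !mxE.
  apply: (gen i).1 => //; apply: (staircase_level stS eZ) => j.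
  rewrite sig0 scale0r add0r; apply: staircase_col => // j' jj.
  by apply: ker_exp_le (Yk j').
split=> //; move: eq0; rewrite Z0 sig0 mulmx0 scale0r mul0mx !subr0 sub0r.
move/eqP; rewrite oppr_eq0 => /eqP YT.
by rewrite -[T]mul1mx -XY -mulmxA YT mulmx0.
Qed.
End Fixed.
End Solve.

(** * The Jacobian *)

(** Every component of f is at most quadratic along a line, its only products of variables being
    those in $\lambda Y$ and $YS$. *)
Lemma derive1_quadratic (K : numFieldType) (a b c : K) :
  derive1 (fun t : K^o => (a + t * b + t ^+ 2 * c : K^o)) 0 = b.
Proof.
rewrite derive1E; set f := fun t => _.
have h1 : is_derive (0 : K^o) (1 : K^o) (id : K^o -> K^o) 1 by exact: is_derive_id.
have h2 := @is_deriveX _ _ _ 2 _ _ _ h1.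
have := is_deriveD (is_deriveD (is_derive_cst (a : K^o) (0 : K^o) 1) (is_deriveZ b h1))
  (is_deriveZ c h2).
set g := (X in is_derive _ _ X _); have -> : g = f.
  by apply/funext => t; rewrite /g /f !fctE /= /GRing.scale /= [b * _]mulrC [c * _]mulrC.
move=> [_ ->]; rewrite /= expr1 mulr0 scale0r scaler0 addr0 add0r.
by rewrite /GRing.scale /= mulr1.
Qed.

Section Residual.
Variables (K : comNzRingType) (n m : nat).
Implicit Types (A : 'M[K]_n) (Y Z : 'M[K]_(n, m)) (S T : 'M[K]_m).

Lemma residual_comb N Y S c s1 s2 Z1 Z2 T1 T2 :
  (N : 'M[K]_n) *m (c *: Z1 + Z2) - (c * s1 + s2) *: Y - (c *: Z1 + Z2) *m S
    - Y *m (c *: T1 + T2) =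
  c *: (N *m Z1 - s1 *: Y - Z1 *m S - Y *m T1) + (N *m Z2 - s2 *: Y - Z2 *m S - Y *m T2).
Proof.
rewrite !mulmxDr mulmxDl -!scalemxAr -scalemxAl.
move: (N *m Z1) (N *m Z2) (Z1 *m S) (Z2 *m S) (Y *m T1) (Y *m T2) => a1 a2 a3 a4 a5 a6.
by apply/matrixP => i j; rewrite !mxE; ring.
Qed.

(** The coefficient of [t] is the differential of $(A-\lambda I)Y-YS$ in the direction $(s,Z,T)$. *)
Lemma residual_line A l s t Y Z S T :
  (A - (l + t * s)%:M) *m (Y + t *: Z) - (Y + t *: Z) *m (S + t *: T) =
  ((A - l%:M) *m Y - Y *m S)
  + t *: ((A - l%:M) *m Z - s *: Y - Z *m S - Y *m T) + t ^+ 2 *: (- (s *: Z) - Z *m T).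
Proof.
rewrite !mulmxBl !mul_scalar_mx !mulmxDr !mulmxDl -!scalemxAr -!scalemxAl.
move: (A *m Y) (A *m Z) (Y *m S) (Z *m S) (Y *m T) (Z *m T) => a1 a2 a3 a4 a5 a6.
by apply/matrixP => i j; rewrite !mxE; ring.
Qed.
End Residual.

(** * The Jacobian as the matrix of the differential *)

Section Jacobian.
Variables (R : realType) (n m k : nat) (A : 'M[R[i]]_n) (lam : R[i]).
Variables (B Cm : 'M[R[i]]_(n, m)).
Local Notation C := (R[i]).
Local Notation w := (weyr A lam).
Local Notation N := (A - lam%:M).
Local Notation V := (Var w k n m).
Local Notation O := (Out w k n m).
Local Notation fm := (@Defs.fmap R n m k A lam B Cm).
Local Notation Lam := (@lam_of R n m k A lam).
Local Notation Yof := (@Y_of R n m k A lam).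
Local Notation Sof := (@S_of R n m k A lam).

(** The differential of [fmap] at $(\lambda,Y,S)$ in the direction [d]; the constants $\delta_{ij}$
    drop out. *)
Definition fmap_lin (Y : 'M[C]_(n, m)) (S : 'M[C]_m) (d : V -> C) (o : O) : C :=
  match o with
  | inl (inl (r, i)) => (N *m Yof d - Lam d *: Y - Yof d *m S - Y *m Sof d) r i
  | inl (inr q) => hdot (col (val q).2 Cm) (col (val q).1 (Yof d))
  | inr q => hdot (col (val q).2 B) (col (val q).1 (Yof d))
  end.

Lemma Y_of_comb c f g : Yof (fun u => c * f u + g u) = c *: Yof f + Yof g.
Proof. by apply/matrixP => r i; rewrite !mxE. Qed.

Lemma S_of_comb c f g : Sof (fun u => c * f u + g u) = c *: Sof f + Sof g.
Proof.
by apply/matrixP => i j; rewrite !mxE; case: insub => [q|] /=; rewrite ?mulr0 ?addr0.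
Qed.

Lemma hdot_comb p (u v v' : 'cV[C]_p) c : hdot u (c *: v + v') = c * hdot u v + hdot u v'.
Proof.
rewrite /hdot mulr_sumr -big_split; apply: eq_bigr => r _ /=.
by rewrite !mxE mulrDr mulrCA.
Qed.

Lemma fmap_lin_comb Y S o c f g :
  fmap_lin Y S (fun u => c * f u + g u) o = c * fmap_lin Y S f o + fmap_lin Y S g o.
Proof.
case: o => [[[r i]|q]|q] /=.
- by rewrite Y_of_comb S_of_comb /lam_of residual_comb mxE [X in X + _]mxE.
- by rewrite Y_of_comb linearD linearZ /= hdot_comb.
- by rewrite Y_of_comb linearD linearZ /= hdot_comb.
Qed.

Definition delta (v u : V) : C := (u == v)%:R.

Lemma fmap_lin_sum Y S o (x : V -> C) :
  fmap_lin Y S x o = \sum_v x v * fmap_lin Y S (delta v) o.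
Proof.
have sumE s : fmap_lin Y S (fun u => \sum_(v <- s) x v * delta v u) o =
    \sum_(v <- s) x v * fmap_lin Y S (delta v) o.
  elim: s => [|v s IH].
    rewrite big_nil (_ : (fun u => _) = fun=> 0); last first.
      by apply/funext => u; rewrite big_nil.
    have := fmap_lin_comb Y S o 1 (fun=> 0) (fun=> 0).
    rewrite (_ : (fun u => _) = fun=> 0); last by apply/funext => u; rewrite mulr0 addr0.
    by rewrite mul1r -[X in X = _]addr0 => /addrI <-.
  rewrite big_cons -IH -fmap_lin_comb; congr (fmap_lin _ _ _ _); apply/funext => u.
  by rewrite big_cons.
rewrite -sumE; congr (fmap_lin _ _ _ _); apply/funext => u.
rewrite (bigD1 u) //= /delta eqxx mulr1 big1 ?addr0 // => v vu.
by rewrite eq_sym (negPf vu) mulr0.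
Qed.

Lemma fmap_line (x d : V -> C) o : Lam x = lam -> exists c, forall t,
  fm (fun u => x u + t * d u) o = fm x o + t * fmap_lin (Yof x) (Sof x) d o + t ^+ 2 * c.
Proof.
move=> xl.
have EY t : Yof (fun u => x u + t * d u) = Yof x + t *: Yof d.
  by rewrite addrC -Y_of_comb; congr Y_of; apply/funext => u; rewrite addrC.
have ES t : Sof (fun u => x u + t * d u) = Sof x + t *: Sof d.
  by rewrite addrC -S_of_comb; congr S_of; apply/funext => u; rewrite addrC.
rewrite /Defs.fmap; case: o => [[[r i]|q]|q] /=.
- exists ((- (Lam d *: Yof d) - Yof d *m Sof d) r i) => t.
  rewrite EY ES /lam_of residual_line -/(lam_of x) xl.
  by rewrite mxE [X in X + _]mxE [X in _ + X + _]mxE [X in _ + X]mxE.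
- by exists 0 => t; rewrite EY [Yof x + _]addrC linearD linearZ /= hdot_comb; ring.
- by exists 0 => t; rewrite EY [Yof x + _]addrC linearD linearZ /= hdot_comb; ring.
Qed.

Lemma jacE (x : V -> C) o v : Lam x = lam ->
  @jac R n m k A lam B Cm x o v = fmap_lin (Yof x) (Sof x) (delta v) o.
Proof.
move=> xl; rewrite /jac; have [c hc] := fmap_line (delta v) o xl.
have -> : (fun t : C^o => (fm (fun u => x u + (if u == v then t else 0)) o : C^o)) =
    (fun t : C^o => (fm x o + t * fmap_lin (Yof x) (Sof x) (delta v) o + t ^+ 2 * c : C^o)).
  apply/funext => t; rewrite -hc; congr (fm _ o); apply/funext => u.
  by rewrite /delta; case: eqP => _; rewrite ?mulr1 ?mulr0.
exact: derive1_quadratic.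
Qed.

(** A kernel vector of the Jacobian is a direction annihilated by the differential. *)
Lemma full_col_rank_lin (Y : 'M[C]_(n, m)) (S : 'M[C]_m) : staircase w k S ->
  (forall d, (forall o, fmap_lin Y S d o = 0) -> forall v, d v = 0) ->
  jac_full_col_rank k A lam B Cm lam Y S.
Proof.
move=> stS inj; rewrite /jac_full_col_rank -mxrank_tr; apply/eqP.
set J := (_^T)%R; change (row_free J); rewrite -kermx_eq0; apply/eqP/row_matrixP => q.
rewrite row0; apply/rowP => p; rewrite [RHS]mxE.
have : row q (kermx J) *m J = 0 by rewrite -row_mul mulmx_ker row0.
set u := row q _ => uJ; pose pt := @Defs.point R n m k A lam lam Y S.
have Yx : Yof pt = Y by apply/matrixP => r i; rewrite mxE.
have Sx : Sof pt = S.
  (* Off the free positions [S_of] returns 0, in agreement with the staircase shape of [S]. *)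
  apply/matrixP => i j; rewrite mxE; case: insubP => [[[i' j'] hq] _ /= [-> ->] //|/= h].
  by rewrite stS // leqNgt.
rewrite -(enum_valK p); apply: (inj (fun v => u 0 (enum_rank v))) => o.
rewrite fmap_lin_sum; have := congr1 (fun M : 'rV[C]_#|{: O}| => M 0 (enum_rank o)) uJ.
rewrite /J !mxE => h; rewrite -[RHS]h.
rewrite [RHS](reindex (@enum_rank V)) /=; last exact: onW_bij (@enum_rank_bij V).
by apply: eq_bigr => v _; rewrite !mxE !enum_rankK jacE // Yx Sx.
Qed.
End Jacobian.

Theorem theorem2 (R : realType) (n m k : nat) (A : 'M[R[i]]_n) (lam : R[i]) :
  eigenvalue A lam ->
  mup lam (char_poly A) = m ->
  (forall j : nat, (0 < j <= k)%N -> (0 < weyr A lam j)%N) ->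
  weyr A lam k.+1 = 0%N ->
  ae_pair (fun B Cm : 'M[R[i]]_(n, m) =>
    exists (Y : 'M[R[i]]_(n, m)) (S : 'M[R[i]]_m),
      [/\ staircase (weyr A lam) k S,
          wsystem k A lam B Cm Y S,
          (forall (Y' : 'M[R[i]]_(n, m)) (S' : 'M[R[i]]_m),
             staircase (weyr A lam) k S' -> wsystem k A lam B Cm Y' S' ->
             Y' = Y /\ S' = S)
        & jac_full_col_rank k A lam B Cm lam Y S]).
Proof.
move=> eA mup_m _ wk.
have mu_k : mu (weyr A lam) k = m by rewrite mu_mup.
have stable (v : 'cV[R[i]]_n) := @weyr_stable R n A lam k v wk.
have m0 : (0 < m)%N.
  rewrite -mup_m -XsubC_dvd ?dvdp_XsubCl -?eigenvalue_root_char //.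
  by rewrite monic_neq0 // char_poly_monic.
have n0 : (0 < n)%N.
  rewrite lt0n; apply/eqP => n0; subst n.
  by have /eigenvalueP[v _ /eqP[]] := eA; exact: thinmx0.
pose i0 : ('I_n * 'I_m) + ('I_n * 'I_m) := inl (Ordinal n0, Ordinal m0).
have /fin_all_exists[E hE] := rnull_not_generic mu_k i0.
(* The exceptional set is the union over the [m] columns. *)
exists (fun x => exists i, E i x); split.
  by apply: cnull_real; apply: (rnull_bigcup (i0, true)) => i; case: (hE i).
move=> x nE; set B := \matrix_(_, _) _; set Cm := \matrix_(_, _) _.
have gen i : generic k A lam B Cm i.
  by case: (hE i) => _; apply => Ei; apply: nE; exists i.
have [Y [S [X [XY stS sys Yk]]]] := system_exists mu_k gen.
exists Y, S; split=> //.
  by move=> Y' S'; apply: (system_unique gen XY Yk sys).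
apply: full_col_rank_lin => // d hd.
have [eY _ _] := sys.
pose T := @S_of R n m k A lam d; pose Z := @Y_of R n m k A lam d.
have stT : staircase (weyr A lam) k T.
  move=> i j ji; rewrite mxE insubF //=.
  by apply/negbTE; rewrite -leqNgt.
have [] := @linearized_injective R n m k A lam mu_k stable B Cm gen Y S X (lam_of d) Z T
  m0 XY Yk stS eY stT.
- by apply/matrixP => r i; have := hd (inl (inl (r, i))); rewrite /= => ->; rewrite mxE.
- move=> i; split=> j h.
    exact: (hd (inl (inr (exist _ (i, j) h)))).
  exact: (hd (inr (exist _ (i, j) h))).
move=> s0 Z0 T0 [[[]|[r i]]|q].
- exact: s0.
- by have := congr1 (fun M : 'M[R[i]]_(n, m) => M r i) Z0; rewrite !mxE.
- have := congr1 (fun M : 'M[R[i]]_m => M (val q).1 (val q).2) T0.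
  by rewrite !mxE -surjective_pairing valK.
Qed.
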